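(* Let $\mathbb{V}=U\oplus W$ be an $n$-dimensional vector space over a finite field $\mathcal{F}$ with $q$ elements, where $U$ and $W$ are nonzero subspaces. Then the girth of the direct sum graph $\Gamma_{U\oplus W}(\mathbb{V})$ is: $\infty$ if $n=2$, $\dim(W)=n-1$ and $q=2$; $3$ if $n=2$, $\dim(W)=n-1$ and $q\neq 2$; $\infty$ if $n=3$, $\dim(W)=n-1$ and $q=2$; $3$ if $n=3$, $\dim(W)=n-1$ and $q\neq 2$; $3$ if $n\geq 4$, $\dim(W)=n-1$ and $q\geq 2$; $3$ if $n\geq 4$, $\dim(W)\leq n-2$ and $q\geq 2$.
   Context: Let $\dim U=r$, $\dim W=s$, $r+s=n$. Fix a basis $\{\alpha_1,\dots,\alpha_r\}$ of $U$ and a basis $\{\beta_1,\dots,\beta_s\}$ of $W$; every $x\in\mathbb{V}$ is written uniquely as $x=\sum_i a_i\alpha_i+\sum_j b_j\beta_j$. The direct sum graph $\Gamma_{U\oplus W}(\mathbb{V})$ is the simple graph whose vertex set is $\{x=u+w: u\in U, w\in W, u\neq 0, w\neq 0\}$, in which two distinct vertices $x,y$ are adjacent iff there is an index $i$ such that the coefficient of $\alpha_i$ is nonzero in both $x$ and $y$, and there is an index $j$ such that the coefficient of $\beta_j$ is nonzero in both $x$ and $y$. The girth is the length of a shortest cycle, and $\infty$ if there is no cycle. *)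

(* Defs.v *)
From HB Require Import structures.
From mathcomp Require Import all_boot all_order all_algebra.
From mathcomp Require Import boolp constructive_ereal.

Set Implicit Arguments.
Unset Strict Implicit.
Unset Printing Implicit Defensive.

Import GRing.Theory.

Local Open Scope ring_scope.

Record simpleGraph := SimpleGraph {
  vertex :> eqType;
  adj : rel vertex;
  adj_sym : symmetric adj;
  adj_irr : irreflexive adj }.

(* In a simple graph a cycle has at least three vertices; [ucycle] alone also
   accepts the empty sequence and a single edge traversed back and forth. *)
Definition has_cycle_of_length (G : simpleGraph) (k : nat) : Prop :=
  exists c : seq G, [/\ ucycle (@adj G) c, (3 <= k)%N & size c = k].

Definition girth (G : simpleGraph) : \bar nat :=
  if pselect (exists k, `[< has_cycle_of_length G k >]) is left h
  then EFin (ex_minn h) else +oo%E.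

Section DirectSumGraph.
Variables (F : finFieldType) (V : vectType F) (U W : {vspace V}).
Variables (r s : nat) (alpha : r.-tuple V) (beta : s.-tuple V).

(* Coefficients in the concatenated family [alpha ++ beta], which is a basis of
   [V] as soon as [alpha] and [beta] are bases of complementary subspaces. *)
Definition coefU (i : 'I_r) (x : V) : F :=
  coord (cat_tuple alpha beta) (lshift s i) x.

Definition coefW (j : 'I_s) (x : V) : F :=
  coord (cat_tuple alpha beta) (rshift r j) x.

Lemma coefUW_sum (x : V) :
  basis_of U alpha -> basis_of W beta ->
  (U + W)%VS = fullv -> directv (U + W) ->
  x = \sum_(i < r) coefU i x *: alpha`_i + \sum_(j < s) coefW j x *: beta`_j.
Proof.
move=> bU bW sUW dUW.
have bV : basis_of (U + W)%VS (cat_tuple alpha beta).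
  exact: cat_basis.
have xV : x \in (U + W)%VS by rewrite sUW memvf.
rewrite {1}(coord_basis bV xV) big_split_ord /=.
congr (_ + _); apply: eq_bigr => i _.
  by rewrite nth_cat size_tuple ltn_ord.
by rewrite nth_cat size_tuple ltnNge leq_addr /= addKn.
Qed.

Definition is_vertex (x : V) : Prop :=
  exists u w : V, [/\ u \in U, w \in W, u != 0, w != 0 & x = u + w].

Definition dsg_vertex := {x : V | `[< is_vertex x >]}.

Definition dsg_adj : rel dsg_vertex := fun x y =>
  [&& x != y,
      [exists i, (coefU i (val x) != 0) && (coefU i (val y) != 0)] &
      [exists j, (coefW j (val x) != 0) && (coefW j (val y) != 0)]].

Lemma dsg_adj_sym : symmetric dsg_adj.
Proof.
move=> x y; rewrite /dsg_adj eq_sym.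
by congr [&& _, _ & _]; apply: eq_existsb => i; rewrite andbC.
Qed.

Lemma dsg_adj_irr : irreflexive dsg_adj.
Proof. by move=> x; rewrite /dsg_adj eqxx. Qed.

Definition direct_sum_graph : simpleGraph :=
  SimpleGraph dsg_adj_sym dsg_adj_irr.

End DirectSumGraph.

Arguments direct_sum_graph {F V} U W {r s} alpha beta.

(* Main.v *)
(* A triangle arises from three vectors whose coefficients at one fixed alpha
   and one fixed beta are all nonzero: take the vector with all coefficients 1
   and modify a single coefficient in two different ways.  This is possible
   when the field has a third element, or when the basis has two further
   members.  In the exceptional cases (q = 2, dim U = 1, dim W <= 2) every edge
   contains the unique vector with all coefficients 1, so the graph is a star
   and has no cycle. *)
Require Import Defs.
From HB Require Import structures.
From mathcomp Require Import all_boot all_order all_algebra.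
From mathcomp Require Import boolp constructive_ereal zify.

Set Implicit Arguments.
Unset Strict Implicit.
Unset Printing Implicit Defensive.

Import GRing.Theory.

Local Open Scope ring_scope.

(** The three edges force the vertices to be distinct by irreflexivity, and no cycle length below 3
    competes because [has_cycle_of_length] excludes it. *)
Lemma girth_triangle (G : simpleGraph) (x y z : G) :
  adj x y -> adj y z -> adj z x -> girth G = EFin 3%N.
Proof.
move=> xy yz zx; have cycle3 : has_cycle_of_length G 3.
  have neq a b : adj a b -> (a == b :> G) = false.
    by move=> ab; apply/eqP => eab; rewrite eab adj_irr in ab.
  exists [:: x; y; z]; split=> //; rewrite /ucycle /= xy yz zx /= !inE.
  by rewrite negb_or (neq _ _ xy) (neq _ _ yz) eq_sym (neq _ _ zx).
rewrite /girth; case: pselect => [h|[]]; last by exists 3%N; apply/asboolP.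
congr EFin; case: ex_minnP => m /asboolP [c [_ m_ge3 _]] m_min.
by apply/eqP; rewrite eqn_leq m_ge3 andbT; apply/m_min/asboolP.
Qed.

(** A cycle contains successive distinct vertices x, y, z. If y is the vertex in [P], the edge
    leaving z avoids it; otherwise the edges xy and yz put both x and z in [P]. *)
Lemma girth_star (G : simpleGraph) (P : pred G) :
  {in P &, forall x y, x = y} -> (forall x y : G, adj x y -> P x || P y) ->
  girth G = +oo%E.
Proof.
move=> P_uniq adjP; suff acyclic k : ~ has_cycle_of_length G k.
  by rewrite /girth; case: pselect => // h; case: {-}h => k /asboolP /acyclic.
case=> c [].
case: c => [|x [|y [|z c]]]; try by move=> _ k_ge3 sk; rewrite -sk in k_ge3.
case/andP=> /= /and3P[xy yz zc] /andP[x_notin /andP[y_notin _]] _ _.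
have xNz : x <> z by move=> xz; rewrite xz !inE eqxx orbT in x_notin.
have yNz : y <> z by move=> yz'; rewrite yz' !inE eqxx in y_notin.
have yNx : y <> x by move=> yx; rewrite yx !inE eqxx in x_notin.
(* w is the successor of z on the cycle, namely x when the cycle is a triangle. *)
have [w zw yNw] : exists2 w, adj z w & y <> w.
  case: c zc y_notin {x_notin} => [|w c] /= /andP[zw _] y_notin.
    by exists x.
  by exists w => // yw; rewrite yw !inE eqxx orbT in y_notin.
have [Py|PyN] := boolP (P y).
  by have /orP[/(P_uniq _ _ Py)|/(P_uniq _ _ Py)] := adjP _ _ zw.
have Px : P x by move: (adjP _ _ xy); rewrite (negPf PyN) orbF.
have Pz : P z by move: (adjP _ _ yz); rewrite (negPf PyN).
by case: xNz; apply: P_uniq.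
Qed.

Lemma card2_neq0_eq1 (F : finFieldType) (c : F) : #|F| = 2%N -> c != 0 -> c = 1.
Proof.
move=> cardF c_neq0; apply/eqP; apply: contraT => c_neq1.
have: (#|[set 0%R; 1%R; c]| <= #|F|)%N by apply: max_card.
rewrite cardF -setUA cardsU1 cards2 !inE ![_ == c]eq_sym ![_ == 1]eq_sym.
by rewrite [1 == 0]oner_eq0 (negPf c_neq0) eq_sym c_neq1.
Qed.

Lemma card_neq2_exists (F : finFieldType) :
  #|F| <> 2%N -> exists2 c : F, c != 0 & c != 1.
Proof.
move=> cardF; have [c|F01] := pickP (fun c : F => (c != 0) && (c != 1)).
  by case/andP=> c0 c1; exists c.
case: cardF; rewrite -cardsT; suff -> : [set: F] = [set 0; 1].
  by rewrite cards2 eq_sym oner_eq0.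
apply/setP => c; rewrite !inE; move: (F01 c).
by case: (c == 0); case: (c == 1).
Qed.

Section Girth.
Variables (F : finFieldType) (V : vectType F) (U W : {vspace V}).
Variables (r s : nat) (alpha : r.-tuple V) (beta : s.-tuple V).
Hypotheses (basisU : basis_of U alpha) (basisW : basis_of W beta).
Hypotheses (sumUW : (U + W)%VS = {:V}%VS) (directUW : directv (U + W)).

Let cU := coefU alpha beta.
Let cW := coefW alpha beta.

Lemma coefUW_inj (x y : V) :
  (forall i, cU i x = cU i y) -> (forall j, cW j x = cW j y) -> x = y.
Proof.
move=> eqU eqW; rewrite (coefUW_sum x basisU basisW sumUW directUW).
rewrite (coefUW_sum y basisU basisW sumUW directUW).
by congr (_ + _); apply: eq_bigr => k _; congr (_ *: _).
Qed.

(** The alpha part and the beta part of x serve as its components; freeness of each basis makes them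
    nonzero as soon as one coefficient is. *)
Lemma coef_neq0_vertex i j (x : V) :
  cU i x != 0 -> cW j x != 0 -> is_vertex U W x.
Proof.
move=> xi xj.
exists (\sum_i cU i x *: alpha`_i), (\sum_j cW j x *: beta`_j); split.
- apply: memv_suml => k _; rewrite memvZ // (basis_mem basisU) //.
  by rewrite mem_nth ?size_tuple.
- apply: memv_suml => k _; rewrite memvZ // (basis_mem basisW) //.
  by rewrite mem_nth ?size_tuple.
- apply: contraNneq xi => u0.
  by rewrite -(coord_sum_free (cU ^~ x) i (basis_free basisU)) u0 linear0.
- apply: contraNneq xj => w0.
  by rewrite -(coord_sum_free (cW ^~ x) j (basis_free basisW)) w0 linear0.
- exact: coefUW_sum basisU basisW sumUW directUW.
Qed.

(** The shared positions i and j witness all three adjacencies at once. *)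
Lemma girth_three_vectors i j (x y z : V) :
  [/\ cU i x != 0, cU i y != 0 & cU i z != 0] ->
  [/\ cW j x != 0, cW j y != 0 & cW j z != 0] ->
  x != y -> y != z -> z != x ->
  girth (direct_sum_graph U W alpha beta) = EFin 3%N.
Proof.
case=> xi yi zi [xj yj zj] xy yz zx.
have vertexP v : cU i v != 0 -> cW j v != 0 -> `[< is_vertex U W v >].
  by move=> vi vj; apply/asboolP; apply: coef_neq0_vertex vi vj.
have adjP (a b : dsg_vertex U W) : cU i (val a) != 0 -> cW j (val a) != 0 ->
    cU i (val b) != 0 -> cW j (val b) != 0 -> val a != val b ->
    dsg_adj alpha beta a b.
  move=> ai aj bi bj ab; apply/and3P; split=> //.
    by apply/existsP; exists i; apply/andP.
  by apply/existsP; exists j; apply/andP.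
apply: (@girth_triangle (direct_sum_graph U W alpha beta)
  (exist _ x (vertexP x xi xj)) (exist _ y (vertexP y yi yj))
  (exist _ z (vertexP z zi zj))); exact: adjP.
Qed.

(** The triangle consists of the all-ones vector and its two variants with d at k or at l. The
    disjunction lists the two ways to keep the coefficients at i and j nonzero: d is itself nonzero,
    or k and l avoid these positions, and then d may be 0. *)
Lemma girth_two_positions i j (k l : 'I_(r + s)) (d : F) :
  k != l -> d != 1 ->
  d != 0 \/ (forall m : 'I_(r + s), m \in [:: k; l] -> m != lshift s i /\ m != rshift r j) ->
  girth (direct_sum_graph U W alpha beta) = EFin 3%N.
Proof.
move=> kl d1 hd; set e := cat_tuple alpha beta.
have free_e : free e by apply: (basis_free (U := (U + W)%VS)); apply: cat_basis.
pose vec (f : 'I_(r + s) -> F) := \sum_m f m *: e`_m.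
have coord_vec f m : coord e m (vec f) = f m by apply: coord_sum_free.
pose one_but (p m : 'I_(r + s)) := if m == p then d else 1 : F.
have neq0 (p : 'I_(r + s)) : p \in [:: k; l] ->
    cU i (vec (one_but p)) != 0 /\ cW j (vec (one_but p)) != 0.
  move=> p_kl; rewrite /cU /cW /coefU /coefW !coord_vec /one_but.
  case: hd => [d0|/(_ p p_kl) [pi pj]].
    by split; case: ifP => _; rewrite ?oner_eq0.
  by rewrite ![_ == p]eq_sym (negPf pi) (negPf pj) oner_eq0.
have [ki kj] := neq0 k (mem_head _ _).
have [li lj] : _ := neq0 l (mem_last k [:: l]).
apply: (@girth_three_vectors i j (vec (fun=> 1)) (vec (one_but k))
  (vec (one_but l))).
- by split; rewrite // /cU /coefU coord_vec oner_eq0.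
- by split; rewrite // /cW /coefW coord_vec oner_eq0.
- apply: contraNneq d1 => /(congr1 (coord e k)).
  by rewrite !coord_vec /one_but eqxx => <-.
(* At k the first variant has d, while the second still has 1 because k differs from l. *)
- apply: contraNneq d1 => /(congr1 (coord e k)).
  by rewrite !coord_vec /one_but eqxx (negPf kl) => ->.
- apply: contraNneq d1 => /(congr1 (coord e l)).
  by rewrite !coord_vec /one_but eqxx => ->.
Qed.

Lemma girth_card_neq2 : (0 < r)%N -> (0 < s)%N -> #|F| <> 2%N ->
  girth (direct_sum_graph U W alpha beta) = EFin 3%N.
Proof.
move=> r_gt0 s_gt0 /card_neq2_exists [c c0 c1].
(* With c outside {0, 1}, the modified positions may be i and j themselves, so one alpha and one
   beta suffice. *)
apply: (@girth_two_positions (Ordinal r_gt0) (Ordinal s_gt0)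
  (lshift s (Ordinal r_gt0)) (rshift r (Ordinal s_gt0)) c) => //.
  by rewrite eq_lrshift.
by left.
Qed.

Lemma girth_dim_ge4 : (0 < r)%N -> (0 < s)%N -> (4 <= r + s)%N ->
  girth (direct_sum_graph U W alpha beta) = EFin 3%N.
Proof.
move=> r_gt0 s_gt0 rs_ge4.
pose a := lshift s (Ordinal r_gt0); pose b := rshift r (Ordinal s_gt0).
(* At least two basis positions remain besides a and b; setting a coefficient there to 0 works over
   every field. *)
have: (1 < #|~: [set a; b]|)%N.
  by rewrite cardsCs setCK cards2 card_ord eq_lrshift; lia.
case/card_gt1P=> k [l [k_ab l_ab kl]].
apply: (@girth_two_positions (Ordinal r_gt0) (Ordinal s_gt0) k l 0) => //.
  by rewrite eq_sym oner_eq0.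
right=> m; rewrite !inE => /orP[]/eqP->.
  by move: k_ab; rewrite !inE negb_or => /andP[].
by move: l_ab; rewrite !inE negb_or => /andP[].
Qed.

Lemma girth_card2 : #|F| = 2%N -> r = 1%N -> (s <= 2)%N ->
  girth (direct_sum_graph U W alpha beta) = +oo%E.
Proof.
move=> cardF r1 s_le2.
have eq_neq0 (c c' : F) : c != 0 -> c' != 0 -> c = c'.
  by move=> /(card2_neq0_eq1 cardF)-> /(card2_neq0_eq1 cardF)->.
have eq_r (i i' : 'I_r) : i = i'.
  by move: i i'; rewrite r1 => i i'; rewrite !ord1.
(* Pigeonhole: as s is at most 2, at most one index differs from j. *)
have eq_s (j j1 j2 : 'I_s) : j1 != j -> j2 != j -> j1 = j2.
  move=> j1j j2j; apply/eqP; apply: contraLR s_le2 => j12; rewrite -ltnNge.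
  have: (#|[set j1; j2; j]| <= #|'I_s|)%N by apply: max_card.
  by rewrite card_ord -setUA cardsU1 cards2 !inE negb_or j12 j1j j2j.
(* The center of the star: over two elements, nonzero coefficients are all 1, so at most one vertex
   is [full]. *)
pose full (x : dsg_vertex U W) :=
  [forall i, cU i (val x) != 0] && [forall j, cW j (val x) != 0].
apply: (@girth_star (direct_sum_graph U W alpha beta) full).
  move=> x y /andP[/forallP xU /forallP xW] /andP[/forallP yU /forallP yW].
  by apply: val_inj; apply: coefUW_inj => k; apply: eq_neq0.
move=> x y /and3P[xNy /existsP[i /andP[xi yi]] /existsP[j /andP[xj yj]]].
have fullU (v : V) : cU i v != 0 -> [forall i, cU i v != 0].
  by move=> vi; apply/forallP => i'; rewrite (eq_r i' i).
(* If neither endpoint is [full], each has a zero beta coefficient, necessarily at the only index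
   other than the shared j; hence all their coefficients agree and x = y. *)
apply: contraR xNy; rewrite /full !fullU //= negb_or !negb_forall.
case/andP=> /existsP[j1 /negPn/eqP xj1] /existsP[j2 /negPn/eqP yj2].
have j1j : j1 != j by apply: contraNneq xj => <-; apply/eqP.
have j2j : j2 != j by apply: contraNneq yj => <-; apply/eqP.
apply/eqP/val_inj; apply: coefUW_inj => [i'|j'].
  by rewrite (eq_r i' i); apply: eq_neq0.
have [->|j'j] := eqVneq j' j; first exact: eq_neq0.
by rewrite {1}(eq_s j j' j1 j'j j1j) xj1 (eq_s j j' j2 j'j j2j) yj2.
Qed.

End Girth.

Theorem theorem3p6 (F : finFieldType) (V : vectType F) (U W : {vspace V})
    (n q : nat)
    (alpha : (\dim U).-tuple V) (beta : (\dim W).-tuple V)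
    (dimV : \dim {:V} = n) (cardF : #|F| = q)
    (U_neq0 : U != 0%VS) (W_neq0 : W != 0%VS)
    (sumUW : (U + W)%VS = {:V}%VS) (directUW : directv (U + W))
    (basisU : basis_of U alpha) (basisW : basis_of W beta) :
  let g := girth (direct_sum_graph U W alpha beta) in
  [/\ n = 2%N -> \dim W = (n - 1)%N -> q = 2%N -> g = +oo%E,
      n = 2%N -> \dim W = (n - 1)%N -> q <> 2%N -> g = EFin 3%N,
      n = 3%N -> \dim W = (n - 1)%N -> q = 2%N -> g = +oo%E,
      n = 3%N -> \dim W = (n - 1)%N -> q <> 2%N -> g = EFin 3%N &
      ((4 <= n)%N -> \dim W = (n - 1)%N -> (2 <= q)%N -> g = EFin 3%N) /\
      ((4 <= n)%N -> (\dim W <= n - 2)%N -> (2 <= q)%N -> g = EFin 3%N)].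
Proof.
move=> g.
have dimUW : (\dim U + \dim W)%N = n.
  by rewrite -dimV -sumUW; apply/esym/eqP; rewrite -directvE.
have dimU_gt0 : (0 < \dim U)%N by rewrite lt0n dimv_eq0.
have dimW_gt0 : (0 < \dim W)%N by rewrite lt0n dimv_eq0.
(* Both acyclic cases at once: here dim U = 1 and dim W is at most 2. *)
have inf : (n <= 3)%N -> \dim W = (n - 1)%N -> q = 2%N -> g = +oo%E.
  by move=> n_le3 dW q2; apply: girth_card2 => //; [rewrite cardF | lia | lia].
have q_neq2 : q <> 2%N -> g = EFin 3%N.
  by rewrite -cardF; apply: girth_card_neq2.
have n_ge4 : (4 <= n)%N -> g = EFin 3%N.
  by rewrite -dimUW; apply: girth_dim_ge4.
split; try (by move=> n_eq; apply: inf; rewrite n_eq); try by move=> _ _.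
by split=> ? _ _; apply: n_ge4.
Qed.
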